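(* Let $X\subset\mathbb{C}^n$ be open and let $U\subset\subset X$ (that is, $U$ is a relatively compact subset of $X$). If $U$ is non-thin at every point of its closure, then for every plurisubharmonic function $u$ on $X$ one has $$\sup_U u=\sup_{\partial U}u.$$
   Context: A set $Y\subset\mathbb{C}^n$ is non-thin at $x\in\mathbb{C}^n$ if $x\in\overline{Y\setminus\{x\}}$ and, for every plurisubharmonic function $u$ defined on a neighbourhood of $x$, $$\limsup_{z\to x,\ z\in Y\setminus\{x\}}u(z)=u(x),$$ where $\limsup_{z\to x,\ z\in E}u(z)=\inf_{r>0}\sup\{u(z): z\in\overline{B}(x,r)\cap E\}$. The constant function $-\infty$ is considered plurisubharmonic. $\partial U$ is the topological boundary of $U$. *)

(* Defs.v *)
From HB Require Import structures.
From mathcomp Require Import all_boot all_order all_algebra.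
From mathcomp Require Import all_classical all_reals all_analysis.
From mathcomp Require Import complex.

Set Implicit Arguments.
Unset Strict Implicit.
Unset Printing Implicit Defensive.

Import Order.TTheory GRing.Theory Num.Theory numFieldNormedType.Exports.
Local Open Scope classical_set_scope.
Local Open Scope ring_scope.

(* R[i] itself carries no topology in the library; seen through this alias it
   gets the one of a numClosedFieldType, i.e. that of the modulus.
   The space C^n is 'rV[Cplx R]_n, with its product topology. *)
Definition Cplx (R : realType) : numClosedFieldType := R[i]%C.

(* Upper semicontinuity at the points of Om.  Only used for open Om, so that the
   values outside of Om are irrelevant. *)
Definition usc_on (R : realType) (T : topologicalType)
    (Om : set T) (u : T -> \bar R) : Prop :=
  forall x, Om x -> forall c : R, (u x < c%:E)%E ->
    \forall y \near x, (u y < c%:E)%E.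

Definition circle_mean (R : realType) (v : Cplx R -> \bar R)
    (a : Cplx R) (r : R) : \bar R :=
  (((2 * pi)^-1)%:E *
   \int[lebesgue_measure]_(t in `[0%R, (2 * pi)%R])
     v (a + (r%:C)%C * (cos t +i* sin t)%C)%R)%E.

(* Functions that are identically -oo (possibly on some components of W only)
   are allowed, both here and in [psh].  Since v is upper semicontinuous, it is
   bounded above on circles, so that the mean is well defined in [-oo, +oo[. *)
Definition subharmonic (R : realType) (W : set (Cplx R))
    (v : Cplx R -> \bar R) : Prop :=
  [/\ forall z, W z -> (v z < +oo)%E,
      usc_on W v &
      forall (a : Cplx R) (r : R), 0 < r ->
        [set z | `|z - a| <= (r%:C)%C] `<=` W ->
        (v a <= circle_mean v a r)%E].

Definition psh (R : realType) (n : nat) (Om : set 'rV[Cplx R]_n)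
    (u : 'rV[Cplx R]_n -> \bar R) : Prop :=
  [/\ forall z, Om z -> (u z < +oo)%E,
      usc_on Om u &
      forall a b : 'rV[Cplx R]_n,
        subharmonic [set l : Cplx R | Om (a + l *: b)]
                    (fun l : Cplx R => u (a + l *: b))].

(* The library norm on 'rV_n is the sup norm, hence the explicit formula. *)
Definition euclidean_closed_ball (R : realType) (n : nat)
    (x : 'rV[Cplx R]_n) (r : R) : set 'rV[Cplx R]_n :=
  [set z | \sum_(j < n) `|z ord0 j - x ord0 j| ^+ 2 <= ((r ^+ 2)%:C)%C].

Definition limsup_along (R : realType) (n : nat) (E : set 'rV[Cplx R]_n)
    (u : 'rV[Cplx R]_n -> \bar R) (x : 'rV[Cplx R]_n) : \bar R :=
  ereal_inf [set ereal_sup (u @` (euclidean_closed_ball x r `&` E)) |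
             r in [set r : R | 0 < r]].

(* Functions on a neighbourhood V of x are represented by total functions whose
   values outside of V are meaningless, hence the intersection with V. *)
Definition nonthin (R : realType) (n : nat) (Y : set 'rV[Cplx R]_n)
    (x : 'rV[Cplx R]_n) : Prop :=
  closure (Y `\ x) x /\
  forall (V : set 'rV[Cplx R]_n) (u : 'rV[Cplx R]_n -> \bar R),
    open V -> V x -> psh V u ->
    limsup_along ((Y `&` V) `\ x) u x = u x.

Definition boundary (T : topologicalType) (A : set T) : set T :=
  closure A `\` interior A.

Definition relatively_compact_in (T : topologicalType) (U X : set T) : Prop :=
  precompact U /\ closure U `<=` X.

(* Main.v *)
Require Import Defs.
From mathcomp Require Import all_boot all_order all_algebra.
From mathcomp Require Import all_classical all_reals all_analysis.
From mathcomp Require Import complex lra.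
Import Order.TTheory GRing.Theory Num.Theory numFieldNormedType.Exports.
Local Open Scope classical_set_scope.
Local Open Scope ring_scope.

Set Implicit Arguments.
Unset Strict Implicit.

(** Non-thinness of U at a point x of its closure, tested against u itself,
    says that u x is a limsup of values of u on U, hence at most the supremum
    over U.  This gives one inequality; the other one is the maximum principle
    for the plurisubharmonic u, which needs a complex direction in which to
    move.  If U is non-empty there is one: non-thinness makes its points limits
    of other points, so that n > 0.

    For the maximum principle (psh_max_on_boundary), u attains its maximum over
    the compact closure of U, since it is upper semicontinuous.  Among the
    maximum points, take one whose j-th coordinate has the largest real part; it
    is called z0.  It lies on the boundary of U: otherwise a closed disc of
    radius r, centred at z0 and parallel to the j-th axis, would lie in U, and
    by the mean value inequality u would also be maximal at z0 + r e_j
    (subharmonic_max_spreads), whose j-th coordinate has a larger real part.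

    In subharmonic_max_spreads, if v (a + r) were less than the value m of v at
    the centre, then v would be at most some c < m on an arc of the circle, by
    upper semicontinuity, and at most m elsewhere; so the circular mean would be
    less than m. *)

(** * Extrema of upper semicontinuous functions *)

Lemma real_between_ereal (R : realType) (x y : \bar R) :
  (x < y)%E -> exists c : R, (x < c%:E < y)%E.
Proof.
case: x y => [a| |] [b| |] //.
- by rewrite lte_fin => ab; exists ((a + b) / 2); rewrite !lte_fin; lra.
- by move=> _; exists (a + 1); rewrite ltry lte_fin; lra.
- by move=> _; exists (b - 1); rewrite ltNyr lte_fin; lra.
- by move=> _; exists 0; rewrite ltry ltNyr.
Qed.

(** If the supremum s is not attained, every point of K has a neighbourhood on
    which u stays below a real number less than s; by compactness one such
    number bounds u on all of K, so that s is not the supremum. *)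
Lemma usc_attains_max (R : realType) (T : topologicalType) (K : set T)
    (u : T -> \bar R) (hK : compact K) (K0 : K !=set0)
    (husc : usc_on K u) :
  exists2 x, K x & forall y, K y -> (u y <= u x)%E.
Proof.
set s := ereal_sup (u @` K).
have us y : K y -> (u y <= s)%E by move=> Ky; apply: ereal_sup_ubound; exists y.
apply: contrapT => nmax.
have lts x : K x -> (u x < s)%E.
  move=> Kx; rewrite ltNge; apply/negP => sx; apply: nmax; exists x => // y Ky.
  exact: le_trans (us y Ky) sx.
have cofin x (Kx : K x) := real_between_ereal (lts x Kx).
(* The filter of the reals that tend to s from below, with s possibly
   infinite; the covering form of compactness is applied to it. *)
pose F := filter_from [set c : R | (c%:E < s)%E]
            (fun c => [set d : R | c <= d /\ (d%:E < s)%E]).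
have FF : Filter F.
  apply: filter_from_filter.
    by case: K0 => x Kx; have [c /andP[_ cs]] := cofin x Kx; exists c.
  move=> i j si sj; exists (Num.max i j).
    by rewrite /mkset /Num.max; case: ifP.
  by move=> d [] /=; rewrite ge_max => /andP[? ?] ?.
have := (compact_near_coveringP K).1 hK R F (fun c y => K y -> (u y < c%:E)%E) FF.
case=> [x Kx|c cs hc].
  have [c /andP[uc cs]] := cofin x Kx.
  exists ([set y | (u y < c%:E)%E], [set d : R | c <= d /\ (d%:E < s)%E]).
    by split; [exact: husc | exists c].
  move=> [y d] /= [yc [cd _]] _; exact: lt_le_trans yc _.
have := hc c (conj (lexx c) cs).
move=> Kc; suff : (s <= c%:E)%E by rewrite leNgt cs.
by apply: ge_ereal_sup => _ [y Ky <-]; apply/ltW/Kc.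
Qed.

(** * Circular means *)

(** Both halves of the integral are suprema over the simple functions lying
    below the integrand, which makes them monotone whether or not f and g are
    measurable, so that the values of u on a circle can be compared with a step
    function from pointwise bounds alone. *)
Lemma integral_mono d (T : measurableType d) (R : realType)
    (mu : {measure set T -> \bar R}) (D : set T) (f g : T -> \bar R) :
  (forall x, D x -> (f x <= g x)%E) ->
  (\int[mu]_(x in D) f x <= \int[mu]_(x in D) g x)%E.
Proof.
move=> fg.
have rfg x : ((f \_ D) x <= (g \_ D) x)%E.
  by rewrite /patch; case: ifPn => // /set_mem /fg.
rewrite /integral; apply: leeB; apply: le_ereal_sup => _ [h hh <-];
  exists h => // x; apply: le_trans (hh x) _.
  by rewrite !funeposE ge_max !le_max rfg lexx orbT.
by rewrite !funenegE ge_max !le_max leeN2 rfg lexx orbT.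
Qed.

(** The integral of the step function with value c up to e and m afterwards
    falls short of m * b by (m - c) * e. *)
Lemma integral_lt_step (R : realType) (f : R -> \bar R) (b e m c : R) :
  0 < e -> e < b -> c < m ->
  (forall t : R, 0 <= t <= b -> (f t <= m%:E)%E) ->
  (forall t : R, 0 <= t <= e -> (f t <= c%:E)%E) ->
  (\int[lebesgue_measure]_(t in `[0%R, b]) f t < (m * b)%:E)%E.
Proof.
move=> e0 eb cm fm fc.
pose g (t : R) := (if t <= e then c else m)%:E.
apply: (@le_lt_trans _ _ (\int[lebesgue_measure]_(t in `[0%R, b]) g t)%E).
  apply: integral_mono => t /=; rewrite in_itv /= => /andP[t0 tb].
  by rewrite /g; case: ifP => te; [apply: fc|apply: fm]; apply/andP.
have -> : [set` `[0%R, b]] = [set` `[0%R, e]] `|` [set` `]e, b]].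
  by rewrite -itv_bndbnd_setU // bnd_simp ltW.
rewrite integral_setU //=; last 2 first.
- apply: measurable_funS measurableT _ _ => //.
  apply/measurable_realfun.measurable_EFinP.
  apply: measurable_fun_ifT => //; exact: measurable_realfun.measurable_fun_ler.
- apply/disj_set2P; rewrite -subset0 => t /= []; rewrite !in_itv /=.
  by move=> /andP[_ te] /andP[et _]; move: (lt_le_trans et te); rewrite ltxx.
rewrite (eq_integral (cst c%:E)); last first.
  by move=> t; rewrite inE /= in_itv /= => /andP[_ te]; rewrite /g te.
rewrite [X in (_ + X)%E](eq_integral (cst m%:E)); last first.
  by move=> t; rewrite inE /= in_itv /= => /andP[te _]; rewrite /g leNgt te.
rewrite !integral_cst // /= !lebesgue_measure_itv /= !lte_fin e0 eb.
rewrite -!EFinB -!EFinM -EFinD lte_fin subr0; nra.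
Qed.

Lemma real_complex_continuous (R : realType) :
  continuous (fun x : R => (x%:C)%C : Cplx R).
Proof.
move=> x; apply/cvgrPdist_lt => -[e f]; rewrite ltcE /= => /andP[/eqP-> e0].
near=> y; rewrite -rmorphB /= normc_def /= expr0n addr0 sqrtr_sqr ltcR.
near: y; apply: (@cvgr_dist_lt _ _ _ (nbhs x) _ id) => //; exact: cvg_id.
Unshelve. all: by end_near. Qed.

Lemma Re_continuous (R : realType) :
  continuous (fun z : Cplx R => complex.Re z).
Proof.
move=> x; apply: (cvgrPdist_lt (FF := nbhs_filter x) _ _).2 => e e0.
near=> y; have : `|x - y| < (e%:C)%C.
  by near: y; apply: (@cvgr_dist_lt _ _ _ (nbhs x) _ id); [exact: cvg_id|rewrite ltcR].
rewrite -ltcR; apply: le_lt_trans.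
by apply: le_trans (normc_ge_Re _); case: (x) (y) => ? ? [].
Unshelve. all: by end_near. Qed.

Lemma circle_param_cvg (R : realType) (a : Cplx R) (r : R) :
  a + (r%:C)%C * (cos t +i* sin t)%C @[t --> (0 : R)] --> a + (r%:C)%C.
Proof.
have E (t : R) : (cos t +i* sin t)%C = (cos t)%:C%C + 'i%C * (sin t)%:C%C :> Cplx R.
  exact: (complexE (cos t +i* sin t)%C).
under eq_fun do rewrite E.
have <- : a + (r%:C)%C * (1 + 'i%C * 0) = a + (r%:C)%C.
  by rewrite mulr0 addr0 mulr1.
apply: cvgD; first exact: cvg_cst.
apply: cvgM; first exact: cvg_cst.
apply: cvgD.
  have <- : (@cos R 0)%:C%C = 1 :> Cplx R by rewrite cos0.
  apply: (@cvg_comp _ _ _ _ (fun x : R => (x%:C)%C : Cplx R)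
    (nbhs (0 : R)) (nbhs (cos 0 : R))).
    exact: continuous_cos.
  exact: real_complex_continuous.
apply: cvgM; first exact: cvg_cst.
have <- : (@sin R 0)%:C%C = 0 :> Cplx R by rewrite sin0.
apply: (@cvg_comp _ _ _ _ (fun x : R => (x%:C)%C : Cplx R)
    (nbhs (0 : R)) (nbhs (sin 0 : R))).
  exact: continuous_sin.
exact: real_complex_continuous.
Qed.

(** The same argument reaches every point of the circle; the rightmost one is
    singled out because it leads out of a set of maximum points whose real
    parts are at most that of a. *)
Lemma subharmonic_max_spreads (R : realType) (W : set (Cplx R))
    (v : Cplx R -> \bar R) (a : Cplx R) (r : R) :
  subharmonic W v -> 0 < r -> [set z | `|z - a| <= (r%:C)%C] `<=` W ->
  (forall z, `|z - a| <= (r%:C)%C -> (v z <= v a)%E) ->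
  (v a <= v (a + (r%:C)%C)%R)%E.
Proof.
move=> [voo vusc vmean] r0 DW vmax; rewrite leNgt; apply/negP => lt_v.
have onD t : `|a + (r%:C)%C * (cos t +i* sin t)%C - a| <= (r%:C)%C :> Cplx R.
  rewrite addrAC subrr add0r normrM !normc_def /= cos2Dsin2 sqrtr1 mulr1.
  by rewrite expr0n addr0 sqrtr_sqr gtr0_norm.
have onD0 : `|a + (r%:C)%C - a| <= (r%:C)%C :> Cplx R.
  have := onD 0; rewrite cos0 sin0.
  by rewrite (_ : (1 +i* 0)%C = 1 :> Cplx R) // mulr1.
have Wa : W a by apply: DW; rewrite /= subrr normr0 ler0c ltW.
have [c /andP[vc cm]] := real_between_ereal lt_v.
have := voo a Wa; case E : (v a) => [m| |] // _; last by rewrite E in cm.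
rewrite E lte_fin in cm.
have pi2 : 0 < 2 * pi :> R by rewrite mulr_gt0 ?pi_gt0.
have : \forall t \near (0 : R), (v (a + (r%:C)%C * (cos t +i* sin t)%C)%R < c%:E)%E.
  exact: (@circle_param_cvg R a r _ (vusc _ (DW _ onD0) c vc)).
move=> /nbhs_ballP[d /= d0 hd].
(* Halving d makes the closed arc up to e fit in the open ball; the bound pi
   leaves a proper remainder of the circle. *)
pose e := Num.min (d / 2) pi.
have e0 : 0 < e by rewrite lt_min pi_gt0 divr_gt0.
have eb : e < 2 * pi.
  by apply: (@le_lt_trans _ _ pi); [rewrite ge_min lexx orbT|have := pi_gt0 R; lra].
have lt_int : (\int[lebesgue_measure]_(t in `[0%R, (2 * pi)%R])
    v (a + (r%:C)%C * (cos t +i* sin t)%C)%R < (m * (2 * pi))%:E)%E.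
  apply: (@integral_lt_step _ _ _ e _ c) => // [t _|t /andP[t0 te]].
    by rewrite -E; exact: vmax.
  apply/ltW/hd; rewrite /ball /= sub0r normrN ger0_norm //.
  apply: le_lt_trans te _; rewrite gt_min; apply/orP; left; lra.
have := vmean a r r0 DW; rewrite E /circle_mean lee_pdivlMl //.
by rewrite -EFinM mulrC leNgt lt_int.
Qed.

(** * The maximum principle *)

Lemma limsup_along_le_sup (R : realType) (n : nat) (E : set 'rV[Cplx R]_n)
    (u : 'rV[Cplx R]_n -> \bar R) (x : 'rV[Cplx R]_n) :
  (limsup_along E u x <= ereal_sup (u @` E))%E.
Proof.
apply: (@le_trans _ _ (ereal_sup (u @` (euclidean_closed_ball x 1 `&` E)))).
  by apply: ereal_inf_lbound; exists 1 => //=; exact: ltr01.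
by apply: le_ereal_sup; apply: image_subset => z [].
Qed.

Lemma line_cvg (K : numFieldType) (V : normedModType K) (z b : V) :
  z + l *: b @[l --> (0 : K)] --> z.
Proof.
suff : z + l *: b @[l --> (0 : K)] --> z + (0 : K) *: b by rewrite scale0r addr0.
have cZ : l *: b @[l --> (0 : K)] --> (0 : K) *: b.
  apply: (cvgZr_tmp (FF := nbhs_filter (0 : K)) (s := id)); exact: cvg_id.
exact: (cvgD (FF := nbhs_filter (0 : K)) (cvg_cst z) cZ).
Qed.

(** Maximizing u and then the real part of the j-th coordinate takes the place
    of the usual connectedness argument, in which the set of maximum points is
    shown to be open and closed in a component of the interior. *)
Lemma psh_max_on_boundary (R : realType) (n : nat) (j : 'I_n)
    (X U : set 'rV[Cplx R]_n) (u : 'rV[Cplx R]_n -> \bar R) :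
  relatively_compact_in U X -> U !=set0 -> psh X u ->
  exists2 x, boundary U x & forall y, closure U y -> (u y <= u x)%E.
Proof.
move=> [+ UX] U0 [uoo uusc upsh]; rewrite precompactE => cptU.
have clU0 : closure U !=set0 by case: U0 => y Uy; exists y; exact: subset_closure.
have usc_clU : usc_on (closure U) u by move=> y /UX; exact: uusc.
have [x0 clx0 x0max] := usc_attains_max cptU clU0 usc_clU.
(* Maximizing w amounts to maximizing Re z_j over the maximum points of u. *)
pose w (z : 'rV[Cplx R]_n) : \bar R :=
  if (u z < u x0)%E then -oo%E else (complex.Re (z ord0 j))%:E.
have w_usc : usc_on (closure U) w.
  move=> y cly c; rewrite /w; case: ifPn => [uy _|_].
    have [d /andP[yd dx0]] := real_between_ereal uy.
    apply: filterS (usc_clU y cly d yd) => z zd.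
    by rewrite (lt_trans zd dx0) ltNyr.
  rewrite lte_fin => yc.
  have reC : {for y, continuous (fun z : 'rV[Cplx R]_n => complex.Re (z ord0 j))}.
    apply: (@cvg_comp _ _ _ (fun z : 'rV[Cplx R]_n => z ord0 j)
      (fun z : Cplx R => complex.Re z) (nbhs y) (nbhs (y ord0 j : Cplx R))).
      exact: coord_continuous.
    exact: Re_continuous.
  near=> z; case: ifP => _; first exact: ltNyr.
  rewrite lte_fin; near: z; exact: (cvgr_lt _ reC).
have [z0 clz0 z0max] := usc_attains_max cptU clU0 w_usc.
have uz0 : u z0 = u x0.
  apply/eqP; rewrite eq_le x0max //= leNgt; apply/negP => lt0.
  by have := z0max x0 clx0; rewrite /w lt0 ltxx.
exists z0; last by move=> y cly; rewrite uz0; exact: x0max.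
split => // intz0.
pose b : 'rV[Cplx R]_n := delta_mx ord0 j.
have cvg_z0 : z0 + l *: b @[l --> (0 : Cplx R)] --> z0.
  exact: line_cvg.
have : \forall l \near (0 : Cplx R), U (z0 + l *: b) by exact: cvg_z0.
move=> /nbhs_ballP[[d d'] /=]; rewrite ltcE /= => /andP[/eqP -> {d'} d0] hd.
pose r := d / 2.
have r0 : 0 < r by rewrite divr_gt0.
have disc l : `|l| <= (r%:C)%C -> U (z0 + l *: b).
  move=> lr; apply: hd; rewrite /ball /= sub0r normrN.
  by apply: le_lt_trans lr _; rewrite ltcR /r; lra.
have clD l : `|l - 0| <= (r%:C)%C -> closure U (z0 + l *: b).
  by rewrite subr0 => /disc; exact: subset_closure.
have ge0 : (u z0 <= u (z0 + (r%:C)%C *: b)%R)%E.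
  have := @subharmonic_max_spreads R _ _ 0 r (upsh z0 b) r0.
  rewrite scale0r addr0 add0r; apply=> l /clD; first exact: UX.
  by move=> cll; rewrite uz0; exact: x0max.
have clr : closure U (z0 + (r%:C)%C *: b).
  apply: clD; rewrite subr0 ger0_norm // ler0c; exact: ltW.
have := z0max _ clr; rewrite /w uz0 ltxx ltNge -uz0 ge0 /= lee_fin.
rewrite !mxE !eqxx /= mulr1.
by case: (z0 ord0 j) => p q /=; rewrite leNgt ltrDl r0.
Unshelve. all: by end_near. Qed.

Theorem theorem7 (R : realType) (n : nat) (X U : set 'rV[Cplx R]_n)
  (hX : open X) (hU : relatively_compact_in U X)
  (hthin : forall x, closure U x -> nonthin U x)
  (u : 'rV[Cplx R]_n -> \bar R) (hu : psh X u) :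
  ereal_sup (u @` U) = ereal_sup (u @` boundary U).
Proof.
have [U0|/set0P U0] := eqVneq U set0.
  by rewrite U0 /boundary closure0 set0D !image_set0.
have [y0 Uy0] := U0.
have n0 : (0 < n)%N.
  rewrite lt0n; apply/negP => /eqP n0.
  move: hX hU hthin hu Uy0; subst n => _ _ hthin _ Uy0.
  have [+ _] := hthin _ (subset_closure Uy0).
  by move=> /(_ setT filterT)[z [[_ zy] _]]; apply: zy; apply/matrixP => i [].
have clU_le x : closure U x -> (u x <= ereal_sup (u @` U))%E.
  move=> clx; have [_ /(_ X u hX (hU.2 x clx) hu) <-] := hthin x clx.
  apply: le_trans (limsup_along_le_sup _ _ _) _.
  by apply: le_ereal_sup; apply: image_subset => z [[]].
have [x bx xmax] := psh_max_on_boundary (Ordinal n0) hU U0 hu.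
apply/eqP; rewrite eq_le; apply/andP; split.
  apply: ge_ereal_sup => _ [y Uy <-].
  apply: le_trans (xmax y (subset_closure Uy)) _.
  by apply: ereal_sup_ubound; exists x.
by apply: ge_ereal_sup => _ [y [cly _] <-]; exact: clU_le.
Qed.
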